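(* Let $X^t\in\mathbb{R}^n$ and let $X^b,\hat U^b,U^b,\eta$ be Gaussian random vectors with values in $\mathbb{R}^n,\mathbb{R}^r,\mathbb{R}^r,\mathbb{R}^m$ such that $(X^b,\hat U^b)$ is jointly Gaussian, $U^b$ is independent of $(X^b,\hat U^b)$, and $\eta$ is independent of $(X^b,\hat U^b,U^b)$, with $\mu_{X^b}=X^t$, $\mu_{U^b}=\mu_{\hat U^b}$, $\mu_\eta=0$, $\Sigma_{\eta,\eta}$ positive definite and $\Sigma_{\hat U^b,\hat U^b}+\Sigma_{U^b,U^b}$ invertible. Let $H\in\mathbb{R}^{m\times n}$, $Y=HX^t+\eta$, and let $$Z^b=X^b-S(\hat U^b-U^b),\qquad S=\Sigma_{X^b,\hat U^b}\big(\Sigma_{\hat U^b,\hat U^b}+\Sigma_{U^b,U^b}\big)^{-1}.$$ For a deterministic $K\in\mathbb{R}^{n\times m}$ set $$Z^a(K)=Z^b-K(HZ^b-Y),\qquad X^a(K)=X^b-K(HX^b-Y),$$ and let $$K_Z=\Sigma_{Z^b,Z^b}H^{\top}\big(H\Sigma_{Z^b,Z^b}H^{\top}+\Sigma_{\eta,\eta}\big)^{-1},\qquad K_X=\Sigma_{X^b,X^b}H^{\top}\big(H\Sigma_{X^b,X^b}H^{\top}+\Sigma_{\eta,\eta}\big)^{-1}$$ be the optimal Kalman gains, minimizing the covariances of $Z^a(K)$ and $X^a(K)$ respectively. Then $$\Sigma_{Z^a(K_Z),Z^a(K_Z)}\;\le\;\Sigma_{X^a(K_X),X^a(K_X)}\;\le\;\Sigma_{X^a(K_Z),X^a(K_Z)},$$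 where $A\le B$ for symmetric matrices means that $B-A$ is positive semidefinite.
   Context: $\mu_W=\mathbb{E}[W]$ and $\Sigma_{V,W}=\mathbb{E}[(V-\mu_V)(W-\mu_W)^{\top}]$. $X^t$ is the true state; $X^b$ is the background principal variate, $\hat U^b$ the control variate, $U^b$ the ancillary variate (independent of the other two), $Z^b$ the total variate, $Y$ the observation with observation error $\eta$, $H$ the linear observation operator. $Z^a(K_Z)$ is the analysis total variate, $X^a(K_Z)$ its principal component, and $X^a(K_X)$ is the Kalman filter analysis applied to the principal variate alone. *)

(* Defs.v *)
From HB Require Import structures.
From mathcomp Require Import all_boot all_order all_algebra.
From mathcomp Require Import all_classical all_reals all_analysis.

Set Implicit Arguments.
Unset Strict Implicit.
Unset Printing Implicit Defensive.

Import Order.TTheory GRing.Theory Num.Theory.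
Import numFieldNormedType.Exports.

Local Open Scope classical_set_scope.
Local Open Scope ring_scope.

Section loewner.
Context {R : realType} {n : nat}.
Implicit Types A B : 'M[R]_n.

Definition psdmx A : Prop :=
  A \is symmetricmx /\ forall x : 'cV[R]_n, 0 <= (x^T *m A *m x) 0 0.

Definition posdefmx A : Prop :=
  A \is symmetricmx /\
  forall x : 'cV[R]_n, x != 0 -> 0 < (x^T *m A *m x) 0 0.

Definition loewner_le A B : Prop := psdmx (B - A).

End loewner.

Section random_vectors.
Context {d : measure_display} {T : measurableType d} {R : realType}.
Variable P : probability T R.

Definition coord n (X : T -> 'cV[R]_n) (i : 'I_n) : T -> R :=
  fun w => X w i 0.

Definition mean n (X : T -> 'cV[R]_n) : 'cV[R]_n :=
  \col_i fine ('E_P[coord X i])%E.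

Definition cov m n (V : T -> 'cV[R]_m) (W : T -> 'cV[R]_n) : 'M[R]_(m, n) :=
  \matrix_(i, j) fine (covariance P (coord V i) (coord W j)).

(* [normal_prob m 0] is by convention the uniform law on [0, 1]; a Gaussian law
   of zero variance has to be the Dirac mass at [m] instead. *)
Definition gaussian_law (m s : R) : set R -> \bar R :=
  if s == 0 then \d_m else normal_prob m s.

(* A random vector is Gaussian when all the linear combinations of its
   coordinates are; its covariance matrix is allowed to be singular. *)
Definition gaussian_vector n (X : T -> 'cV[R]_n) : Prop :=
  (forall i, measurable_fun [set: T] (coord X i)) /\
  forall a : 'rV[R]_n, exists m s : R, forall B : set R, measurable B ->
    P ((fun w => (a *m X w) 0 0) @^-1` B) = gaussian_law m s B.

Definition jointly_gaussian m n (X : T -> 'cV[R]_m) (Y : T -> 'cV[R]_n) : Prop :=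
  gaussian_vector (fun w => col_mx (X w) (Y w)).

(* [g_sigma_preimage (coord X)] is the sigma-algebra generated by [X]. *)
Definition independent m n (X : T -> 'cV[R]_m) (Y : T -> 'cV[R]_n) : Prop :=
  forall A B : set T, g_sigma_preimage (coord X) A ->
    g_sigma_preimage (coord Y) B -> P (A `&` B) = (P A * P B)%E.

End random_vectors.

Section control_variate_kalman.
Context {R : realType}.

Definition kalman_gain m n (Sigma : 'M[R]_n) (H : 'M[R]_(m, n))
    (Sigma_eta : 'M[R]_m) : 'M[R]_(n, m) :=
  Sigma *m H^T *m invmx (H *m Sigma *m H^T + Sigma_eta).

Definition analysis (T : Type) m n (H : 'M[R]_(m, n)) (Y : T -> 'cV[R]_m)
    (V : T -> 'cV[R]_n) (K : 'M[R]_(n, m)) : T -> 'cV[R]_n :=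
  fun w => V w - K *m (H *m V w - Y w).

Definition control_gain {d : measure_display} {T : measurableType d}
    (P : probability T R) n r (X : T -> 'cV[R]_n) (Uhat U : T -> 'cV[R]_r) :
    'M[R]_(n, r) :=
  cov P X Uhat *m invmx (cov P Uhat Uhat + cov P U U).

Definition total_variate (T : Type) n r (S : 'M[R]_(n, r))
    (X : T -> 'cV[R]_n) (Uhat U : T -> 'cV[R]_r) : T -> 'cV[R]_n :=
  fun w => X w - S *m (Uhat w - U w).

End control_variate_kalman.

(* Main.v *)
(* For a deterministic gain K the analysis covariance is the Joseph form
   J(Sigma, K) = (1 - K H) Sigma (1 - K H)^T + K Q K^T, with Q the covariance of
   the observation error, because the error is uncorrelated with the variate. It
   is monotone in Sigma, and completing the square around the Kalman gain K0,
     J(Sigma, K) - J(Sigma, K0) = (K - K0) (H Sigma H^T + Q) (K - K0)^T,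
   shows that K0 minimizes it. Since S is the regression coefficient,
   Sigma_Z = Sigma_X - S M S^T <= Sigma_X with M = Sigma_Uhat + Sigma_U, hence
     J(Sigma_Z, K_Z) <= J(Sigma_Z, K_X) <= J(Sigma_X, K_X) <= J(Sigma_X, K_Z).
   Gaussianity only enters through square integrability, and independence only
   through the vanishing of cross covariances. *)
Require Import Defs.
From HB Require Import structures.
From mathcomp Require Import all_boot all_order all_algebra.
From mathcomp Require Import ring lra.
From mathcomp Require Import all_classical all_reals all_analysis.
From mathcomp Require Import measurable_realfun.

Set Implicit Arguments.
Unset Strict Implicit.
Unset Printing Implicit Defensive.

Import Order.TTheory GRing.Theory Num.Theory.
Import numFieldNormedType.Exports.

Local Open Scope classical_set_scope.
Local Open Scope ring_scope.

(** * Positive semidefinite matrices and the Loewner order *)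

Section loewner_order.
Context {R : realType}.

(** [symmetricmx] is the hermitian predicate with trivial sign and identity conjugation; both are
    cleared here once and for all. *)
Lemma trmx_symmetric n (A : 'M[R]_n) : A \is symmetricmx <-> A^T = A.
Proof.
split=> [/is_hermitianmxP AE|AE]; last first.
  by apply/is_hermitianmxP; rewrite expr0 scale1r map_mx_id// AE.
by rewrite [in RHS]AE expr0 scale1r map_mx_id.
Qed.

Lemma psdmxD n (A B : 'M[R]_n) : psdmx A -> psdmx B -> psdmx (A + B).
Proof.
move=> [/trmx_symmetric sA pA] [/trmx_symmetric sB pB]; split=> [|x].
  by apply/trmx_symmetric; rewrite linearD /= sA sB.
by rewrite mulmxDr mulmxDl mxE addr_ge0.
Qed.

Lemma posdefmx_psdmx n (A : 'M[R]_n) : posdefmx A -> psdmx A.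
Proof.
move=> [sA pA]; split=> // x; have [->|/pA/ltW//] := eqVneq x 0.
by rewrite mulmx0 mxE.
Qed.

Lemma psdmx_congr m n (A : 'M[R]_n) (M : 'M[R]_(m, n)) :
  psdmx A -> psdmx (M *m A *m M^T).
Proof.
move=> [/trmx_symmetric sA pA]; split=> [|x].
  by apply/trmx_symmetric; rewrite !trmx_mul trmxK sA mulmxA.
by have := pA (M^T *m x); rewrite trmx_mul trmxK !mulmxA.
Qed.

(** A nonzero row [v] in the kernel of [A + B] would give [v (A + B) v^T = 0], whereas the [B] part
    of this form is positive and the [A] part nonnegative. *)
Lemma posdefmx_psdD_unit n (A B : 'M[R]_n) :
  psdmx A -> posdefmx B -> A + B \in unitmx.
Proof.
move=> [_ pA] [_ pB]; rewrite -row_free_unit; apply: inj_row_free => v v0.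
apply/eqP; apply: contraT => vN0.
have /pB : v^T != 0 by rewrite -trmx0 (inj_eq trmx_inj).
rewrite trmxK; have := pA v^T; rewrite trmxK => Av /(ler_ltD Av).
have <- : (v *m (A + B) *m v^T) 0 0 = (v *m A *m v^T) 0 0 + (v *m B *m v^T) 0 0.
  by rewrite mulmxDr mulmxDl mxE.
by rewrite v0 mul0mx mxE addr0 ltxx.
Qed.

Lemma loewner_le_trans n (A B C : 'M[R]_n) :
  loewner_le A B -> loewner_le B C -> loewner_le A C.
Proof.
rewrite /loewner_le => AB BC.
by rewrite -(subrKA B); exact: psdmxD.
Qed.

End loewner_order.

(** * Joseph form and optimality of the Kalman gain *)

Section kalman.
Context {R : realType} {m n : nat}.
Implicit Types (Sigma : 'M[R]_n) (H : 'M[R]_(m, n)) (Q : 'M[R]_m)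
  (K : 'M[R]_(n, m)).

Definition joseph_form Sigma H Q K : 'M[R]_n :=
  (1%:M - K *m H) *m Sigma *m (1%:M - K *m H)^T + K *m Q *m K^T.

Lemma joseph_form_le Sigma1 Sigma2 H Q K : loewner_le Sigma1 Sigma2 ->
  loewner_le (joseph_form Sigma1 H Q K) (joseph_form Sigma2 H Q K).
Proof.
move=> S12; rewrite /loewner_le /joseph_form opprD addrACA subrr addr0.
by rewrite -mulmxBl -mulmxBr; exact: psdmx_congr.
Qed.

Lemma joseph_form_square Sigma H Q K :
  psdmx Sigma -> posdefmx Q ->
  let Kmin := kalman_gain Sigma H Q in
  joseph_form Sigma H Q K - joseph_form Sigma H Q Kmin =
  (K - Kmin) *m (H *m Sigma *m H^T + Q) *m (K - Kmin)^T.
Proof.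
move=> pS pQ Kmin.
have /trmx_symmetric sS := pS.1; have /trmx_symmetric sQ := pQ.1.
set D := H *m Sigma *m H^T + Q.
have KD : Kmin *m D = Sigma *m H^T.
  by rewrite mulmxKV// posdefmx_psdD_unit//; exact: psdmx_congr.
have sD : D^T = D by rewrite linearD /= !trmx_mul trmxK sS sQ mulmxA.
have DK : D *m Kmin^T = H *m Sigma.
  by rewrite -[LHS]trmxK trmx_mul trmxK sD KD trmx_mul trmxK sS.
(* With [Sigma H^T = Kmin D] and its transpose, the Joseph form is a quadratic in [L] written with
   [D] and [Kmin] only, so completing the square becomes formal. *)
have JE L : joseph_form Sigma H Q L =
    Sigma - L *m (D *m Kmin^T) - Kmin *m D *m L^T + L *m D *m L^T.
  rewrite KD DK /joseph_form /D linearB /= trmx1 trmx_mul.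
  rewrite !(mulmxBl, mulmxBr, mulmxDl, mulmxDr) !mul1mx mulmx1 !mulmxA.
  rewrite mulmx1 !mulNmx opprK.
  by rewrite -!addrA; congr (_ + _); rewrite addrCA.
rewrite !JE linearB /= !(mulmxBl, mulmxBr) !mulmxA.
move: (K *m D *m K^T) (Kmin *m D *m K^T) (K *m D *m Kmin^T)
  (Kmin *m D *m Kmin^T) => a b c e.
by apply/matrixP => i j; rewrite !mxE; ring.
Qed.

Lemma kalman_gain_min Sigma H Q K : psdmx Sigma -> posdefmx Q ->
  loewner_le (joseph_form Sigma H Q (kalman_gain Sigma H Q))
             (joseph_form Sigma H Q K).
Proof.
move=> pS pQ; rewrite /loewner_le joseph_form_square//.
by apply/psdmx_congr/psdmxD; [exact: psdmx_congr|exact: posdefmx_psdmx].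
Qed.

End kalman.

(** * Second moment of the normal law *)

Section normal_second_moment.
Context {R : realType}.
Local Notation mu := lebesgue_measure.

Lemma ge0_integral_normal_prob (m s : R) (f : R -> R) :
  measurable_fun setT f -> (forall x, 0 <= f x) ->
  (\int[normal_prob m s]_x (f x)%:E =
   \int[mu]_x (f x * normal_pdf m s x)%:E)%E.
Proof.
move=> mf f0; have dom := normal_prob_dominates m s.
have mpdf : measurable_fun setT (fun x => (normal_pdf m s x)%:E).
  by apply/measurable_EFinP; exact: measurable_normal_pdf.
rewrite -(Radon_Nikodym_SigmaFinite.change_of_variables dom)//=; last first.
  exact/measurable_EFinP.
have mRN := Radon_Nikodym_SigmaFinite.f_integrable dom.
apply: ae_eq_integral => //.
- apply: emeasurable_funM; first exact/measurable_EFinP.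
  exact: measurable_int mRN.
- apply/measurable_EFinP; apply: measurable_funM => //.
  exact: measurable_normal_pdf.
under [X in ae_eq _ _ _ X]eq_fun do rewrite EFinM.
(* The Radon-Nikodym derivative and [normal_pdf] have the same integral over every measurable set,
   hence agree almost everywhere. *)
apply: ae_eqe_mul2l; apply: integral_ae_eq => //.
by move=> A _ mA; rewrite -Radon_Nikodym_SigmaFinite.f_integral.
Qed.

(* Doubling the deviation absorbs the factor [x ^+ 2], which reduces the second
   moment to the normalization of [normal_pdf m (s *+ 2)]. *)
Lemma sqr_normal_pdf_le (m s x : R) : s != 0 ->
  x ^+ 2 * normal_pdf m s x <=
  (m ^+ 2 *+ 2 + s ^+ 2 *+ 6) * (normal_peak s / normal_peak (s *+ 2)) *
  normal_pdf m (s *+ 2) x.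
Proof.
move=> s0; have s20 : s *+ 2 != 0 by rewrite mulrn_eq0.
rewrite !normal_pdfE//.
have := normal_peak_gt0 s20; have := normal_peak_ge0 s.
move: (normal_peak s) (normal_peak (s *+ 2)) => p q p0 q0.
suff : x ^+ 2 * normal_fun m s x <=
    (m ^+ 2 *+ 2 + s ^+ 2 *+ 6) * normal_fun m (s *+ 2) x.
  move: (m ^+ 2 *+ 2 + s ^+ 2 *+ 6) => c.
  move: (normal_fun m s x) (normal_fun m (s *+ 2) x) => f g cfg.
  have -> : c * (p / q) * (q * g) = p * (c * g) by field; rewrite gt_eqF.
  by rewrite mulrCA ler_wpM2l.
rewrite /normal_fun; set u := (x - m) ^+ 2 / s ^+ 2.
have u0 : 0 <= u by rewrite divr_ge0// sqr_ge0.
(* The exponent [- u / 2] splits so that [- u / 8], the exponent for the deviation [s *+ 2], cancels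
   on both sides. *)
rewrite (_ : - (x - m) ^+ 2 / (s ^+ 2 *+ 2) = - (3 / 8 * u) - u / 8); last first.
  by rewrite /u; field.
rewrite (_ : - (x - m) ^+ 2 / ((s *+ 2) ^+ 2 *+ 2) = - (u / 8)); last first.
  by rewrite /u; field.
rewrite expRD mulrA ler_wpM2r ?expR_ge0// expRN ler_pdivrMr ?expR_gt0//.
have xm : (x - m) ^+ 2 = s ^+ 2 * u by rewrite /u; field.
have c0 : 0 <= m ^+ 2 *+ 2 + s ^+ 2 *+ 6.
  by rewrite addr_ge0// mulrn_wge0// sqr_ge0.
(* Since [expR (3 / 8 * u) >= 1 + 3 / 8 * u], a polynomial bound suffices: [x^2 <= 2 m^2 + 2 s^2 u]
   because [(x - 2 m)^2 >= 0], and the constant 6 works as [6 * 3 / 8 >= 2]. *)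
apply: (le_trans _ (ler_wpM2l c0 (expR_ge1Dx _))).
have := sqr_ge0 m; have := sqr_ge0 s => ss mm.
have := mulr_ge0 mm u0; have := mulr_ge0 ss u0; have := sqr_ge0 (x - m *+ 2).
nra.
Qed.

Lemma integral_sqr_normal_prob_lty (m s : R) : s != 0 ->
  (\int[normal_prob m s]_x (x ^+ 2)%:E < +oo)%E.
Proof.
move=> s0; rewrite ge0_integral_normal_prob//; last by move=> x; exact: sqr_ge0.
set c := (m ^+ 2 *+ 2 + s ^+ 2 *+ 6) * (normal_peak s / normal_peak (s *+ 2)).
apply: (@le_lt_trans _ _ (\int[mu]_x (c%:E * (normal_pdf m (s *+ 2) x)%:E))%E).
  apply: ge0_le_integral => //.
  - by move=> x _; rewrite lee_fin mulr_ge0 ?sqr_ge0 ?normal_pdf_ge0.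
  - apply/measurable_EFinP; apply: measurable_funM.
      exact: exprn_measurable.
    exact: measurable_normal_pdf.
  - apply/measurable_EFinP; apply: measurable_funM => //.
    exact: measurable_normal_pdf.
  - by move=> x _; rewrite -EFinM lee_fin; exact: sqr_normal_pdf_le.
rewrite integralZl//; last exact: integrable_normal_pdf.
by rewrite integral_normal_pdf mule1 ltry.
Qed.

End normal_second_moment.

(** * Square integrability of Gaussian vectors *)

Section gaussian_second_moment.
Context {d : measure_display} {T : measurableType d} {R : realType}.
Variable P : probability T R.
Local Notation coord := Defs.coord.

Lemma gaussian_law_Lfun2 (X : T -> R) (m s : R) :
  measurable_fun setT X ->
  (forall B, measurable B -> P (X @^-1` B) = gaussian_law m s B) ->
  X \in Lfun P 2%:E.
Proof.
move=> mX lawX; rewrite inE; apply/andP; split; rewrite inE//=.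
rewrite /finite_norm unlock/= poweR_lty//.
under eq_integral do rewrite -[2%R]/(2%:R) powR_mulrn// real_normK ?num_real//.
(* [normal_prob] is a measure for the display of [measurableTypeR R], which is
   not the default display of [R]. *)
have mX' : measurable_fun (setT : set T) (X : T -> measurableTypeR R) by [].
pose X' : {mfun T >-> measurableTypeR R} :=
  HB.pack X (isMeasurableFun.Build _ _ T (measurableTypeR R) X mX').
have mf : measurable_fun setT (fun x : measurableTypeR R => (x ^+ 2)%:E).
  by apply/measurable_EFinP; exact: exprn_measurable.
rewrite -[X in (X < _)%E](@ge0_integral_distribution _ _ _ _ _ P X'
  (fun x => (x ^+ 2)%:E))//; last first.
  by move=> x; rewrite lee_fin sqr_ge0.
(* The second moment is now an integral against the law of [X]: a Dirac mass if [s = 0], a normal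
   law otherwise. *)
move: lawX; rewrite /gaussian_law; have [_|s0] := eqVneq s 0 => lawX.
  rewrite (eq_measure_integral (@dirac _ (measurableTypeR R) m R)); last first.
    by move=> A mA _; exact: lawX.
  by rewrite integral_dirac// diracT mul1e ltry.
apply: le_lt_trans (integral_sqr_normal_prob_lty m s0).
rewrite le_eqVlt; apply/orP; left; apply/eqP.
by apply: eq_measure_integral => A mA _; exact: lawX.
Qed.

Lemma gaussian_vector_Lfun2 n (X : T -> 'cV[R]_n) i :
  gaussian_vector P X -> coord X i \in Lfun P 2%:E.
Proof.
(* Coordinate [i] is the linear combination with coefficient row [delta_mx 0 i]. *)
move=> [mX /(_ (delta_mx 0 i))[m [s lawX]]].
apply: (@gaussian_law_Lfun2 _ m s) => // B /lawX <-; congr (P (_ @^-1` B)).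
by apply/funext => w; rewrite -rowE mxE.
Qed.

End gaussian_second_moment.

(** * Expectation of a product of independent variables *)

Section independence.
Context {d : measure_display} {T : measurableType d} {R : realType}.
Variable P : probability T R.

(** Independence makes the joint law the product of the marginal laws, and Fubini then factors the
    integral of [x * y]. *)
Lemma expectationM_indep (X Y : T -> R) :
    X \in Lfun P 2%:E -> Y \in Lfun P 2%:E ->
    (forall A B, measurable A -> measurable B ->
      P (X @^-1` A `&` Y @^-1` B) = (P (X @^-1` A) * P (Y @^-1` B))%E) ->
  ('E_P[X * Y] = 'E_P[X] * 'E_P[Y])%E.
Proof.
move=> X2 Y2 XY.
have mX : measurable_fun setT X.
  by move: X2; rewrite inE => /andP[]; rewrite inE.
have mY : measurable_fun setT Y.
  by move: Y2; rewrite inE => /andP[]; rewrite inE.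
have iXY : P.-integrable setT (EFin \o (X \* Y)).
  by apply/Lfun1_integrable; exact: Lfun2_mul_Lfun1.
have iX : P.-integrable setT (EFin \o X).
  by apply/Lfun1_integrable/Lfun_subset12 => //; exact: fin_num_measure.
have iY : P.-integrable setT (EFin \o Y).
  by apply/Lfun1_integrable/Lfun_subset12 => //; exact: fin_num_measure.
pose X' : {mfun T >-> R} := HB.pack X (isMeasurableFun.Build _ _ _ _ X mX).
pose Y' : {mfun T >-> R} := HB.pack Y (isMeasurableFun.Build _ _ _ _ Y mY).
pose Z w := (X w, Y w).
have mZ : measurable_fun setT Z by exact: measurable_fun_pair.
pose Z' : {mfun T >-> (R * R)%type} :=
  HB.pack Z (isMeasurableFun.Build _ _ _ _ Z mZ).
pose PX := distribution P X'; pose PY := distribution P Y'.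
pose PZ := distribution P Z'.
(* Agreement on measurable rectangles determines the product measure. *)
have PZE A : measurable A -> (PX \x PY)%E A = PZ A.
  by apply: product_measure_unique => B C mB mC; rewrite -XY.
pose f (z : R * R) := (z.1 * z.2)%:E.
have mf : measurable_fun setT f.
  by apply/measurable_EFinP; apply: measurable_funM.
have iZ : PZ.-integrable setT f by exact: integrable_pushforward.
have ifXY : (PX \x PY)%E.-integrable setT f.
  apply/integrableP; split=> //; move/integrableP : iZ => [_].
  congr (_ < _)%E; apply: eq_measure_integral => A mA _; exact/esym/PZE.
rewrite unlock.
transitivity (\int[PZ]_z f z)%E; first by rewrite integral_pushforward.
transitivity (\int[PX \x PY]_z f z)%E.
  by apply: eq_measure_integral => A mA _; exact/esym/PZE.
rewrite -integral12_prod_meas1//.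
have [EX EY] : (\int[P]_w (X w)%:E)%E = (\int[PX]_x x%:E)%E /\
  (\int[P]_w (Y w)%:E)%E = (\int[PY]_x x%:E)%E.
  by split; rewrite integral_pushforward//; exact/measurable_EFinP.
have fY : (\int[PY]_y y%:E)%E \is a fin_num.
  by rewrite -EY; exact: integrable_fin_num.
(* Finiteness of the mean of [Y] lets it enter the outer integral as a real constant, to be matched
   with the inner integral pointwise. *)
rewrite EX EY -(fineK fY) -integralZr//; last first.
  by apply: integrable_pushforward => //; exact/measurable_EFinP.
apply: eq_integral => x _; rewrite fineK// /fubini_F /f/=.
under eq_integral do rewrite EFinM.
rewrite integralZl//.
apply: integrable_pushforward => //; exact/measurable_EFinP.
Qed.

End independence.

(** * Calculus of covariance matrices *)

Section covariance_matrix.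
Context {d : measure_display} {T : measurableType d} {R : realType}.
Variable P : probability T R.
Local Notation coord := Defs.coord.

Definition square_integrable n (V : T -> 'cV[R]_n) : Prop :=
  forall i, coord V i \in Lfun P 2%:E.

Lemma Lfun2_Lfun1 (X : T -> R) : X \in Lfun P 2%:E -> X \in Lfun P 1.
Proof. by apply: Lfun_subset12; exact: fin_num_measure. Qed.

Lemma Lfun2_mulr_Lfun1 (X Y : T -> R) :
  X \in Lfun P 2%:E -> Y \in Lfun P 2%:E -> (X * Y)%R \in Lfun P 1.
Proof. exact: Lfun2_mul_Lfun1. Qed.

(** The entries of [cov] go through [fine], which respects sums and products only at finite values;
    the bilinearity of [cov] rests on this. *)
Lemma covariance_fin_num2 (X Y : T -> R) :
  X \in Lfun P 2%:E -> Y \in Lfun P 2%:E -> covariance P X Y \is a fin_num.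
Proof.
move=> X2 Y2; apply: covariance_fin_num;
  by rewrite ?Lfun2_mulr_Lfun1 ?Lfun2_Lfun1.
Qed.

Lemma Lfun2_sum n (X : 'I_n -> T -> R) (a : 'I_n -> R) :
  (forall i, X i \in Lfun P 2%:E) ->
  (fun w => \sum_i a i * X i w) \in Lfun P 2%:E.
Proof.
move=> X2; rewrite (_ : (fun w => _) = \sum_i a i \o* X i); last first.
  apply/funext => w; rewrite fct_sumE.
  by apply: eq_bigr => i _; rewrite /= mulrC.
apply: rpred_sum; rewrite ?lee1n// => ? i _.
by apply: Lfun_scale; rewrite ?ler1n.
Qed.

Lemma covariance_suml n (X : 'I_n -> T -> R) (a : 'I_n -> R) (Y : T -> R) :
  (forall i, X i \in Lfun P 2%:E) -> Y \in Lfun P 2%:E ->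
  fine (covariance P (fun w => \sum_i a i * X i w) Y) =
  \sum_i a i * fine (covariance P (X i) Y).
Proof.
move=> + Y2; elim: n X a => [X a _|n IHn X a X2].
  rewrite big_ord0 (_ : (fun w => _) = cst 0) ?covariance_cst_l//.
  by apply/funext => w; rewrite big_ord0.
rewrite (_ : (fun w => _) =
    (a ord0 \o* X ord0) \+
    (fun w => \sum_i a (lift ord0 i) * X (lift ord0 i) w)); last first.
  by apply/funext => w; rewrite big_ord_recl /= mulrC.
have aX2 : a ord0 \o* X ord0 \in Lfun P 2%:E.
  by apply: Lfun_scale => //; rewrite ler1n.
have sX2 := Lfun2_sum (fun i => a (lift ord0 i)) (fun i => X2 (lift ord0 i)).
rewrite covarianceDl// fineD ?covariance_fin_num2// big_ord_recl IHn//.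
congr (_ + _); rewrite covarianceZl ?Lfun2_mulr_Lfun1 ?Lfun2_Lfun1//.
by rewrite fineM ?covariance_fin_num2.
Qed.

Lemma square_integrableD n (V W : T -> 'cV[R]_n) :
  square_integrable V -> square_integrable W ->
  square_integrable (fun w => V w + W w).
Proof.
move=> V2 W2 i.
rewrite (_ : coord _ i = coord V i \+ coord W i) ?rpredD ?lee1n//.
by apply/funext => w; rewrite /Defs.coord mxE.
Qed.

Lemma square_integrable_mul m n (A : 'M[R]_(m, n)) (V : T -> 'cV[R]_n) :
  square_integrable V -> square_integrable (fun w => A *m V w).
Proof.
move=> V2 i.
rewrite (_ : coord _ i = fun w => \sum_j A i j * coord V j w) ?Lfun2_sum//.
by apply/funext => w; rewrite /Defs.coord mxE.
Qed.

Lemma square_integrable_cst n (c : 'cV[R]_n) : square_integrable (fun=> c).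
Proof. by move=> i; exact: Lfun_cst. Qed.

Lemma trmx_cov m n (V : T -> 'cV[R]_m) (W : T -> 'cV[R]_n) :
  (cov P V W)^T = cov P W V.
Proof. by apply/matrixP => i j; rewrite !mxE covarianceC. Qed.

Lemma covDl m n (V V' : T -> 'cV[R]_m) (W : T -> 'cV[R]_n) :
  square_integrable V -> square_integrable V' -> square_integrable W ->
  cov P (fun w => V w + V' w) W = cov P V W + cov P V' W.
Proof.
move=> V2 V2' W2; apply/matrixP => i j; rewrite !mxE.
rewrite (_ : coord _ i = coord V i \+ coord V' i); last first.
  by apply/funext => w; rewrite /Defs.coord mxE.
by rewrite covarianceDl// fineD ?covariance_fin_num2.
Qed.

Lemma cov_mull m n p (A : 'M[R]_(p, m)) (V : T -> 'cV[R]_m)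
    (W : T -> 'cV[R]_n) :
  square_integrable V -> square_integrable W ->
  cov P (fun w => A *m V w) W = A *m cov P V W.
Proof.
move=> V2 W2; apply/matrixP => i j; rewrite !mxE.
rewrite (_ : coord _ i = fun w => \sum_k A i k * coord V k w); last first.
  by apply/funext => w; rewrite /Defs.coord mxE.
by rewrite covariance_suml//; apply: eq_bigr => k _; rewrite mxE.
Qed.

Lemma cov_cstl m n (c : 'cV[R]_m) (W : T -> 'cV[R]_n) : cov P (fun=> c) W = 0.
Proof.
by apply/matrixP => i j; rewrite !mxE (covariance_cst_l P (c i 0)).
Qed.

Lemma covDr m n (V : T -> 'cV[R]_m) (W W' : T -> 'cV[R]_n) :
  square_integrable V -> square_integrable W -> square_integrable W' ->
  cov P V (fun w => W w + W' w) = cov P V W + cov P V W'.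
Proof.
by move=> V2 W2 W2'; rewrite -trmx_cov covDl// linearD /= !trmx_cov.
Qed.

Lemma cov_mulr m n p (A : 'M[R]_(p, n)) (V : T -> 'cV[R]_m)
    (W : T -> 'cV[R]_n) :
  square_integrable V -> square_integrable W ->
  cov P V (fun w => A *m W w) = cov P V W *m A^T.
Proof. by move=> V2 W2; rewrite -trmx_cov cov_mull// trmx_mul trmx_cov. Qed.

Lemma cov_cstr m n (V : T -> 'cV[R]_m) (c : 'cV[R]_n) : cov P V (fun=> c) = 0.
Proof. by rewrite -trmx_cov cov_cstl trmx0. Qed.

(** The quadratic form at [x] is the variance of the scalar variable [x^T V]. *)
Lemma psdmx_cov n (V : T -> 'cV[R]_n) :
  square_integrable V -> psdmx (cov P V V).
Proof.
move=> V2; split=> [|x]; first by apply/trmx_symmetric; exact: trmx_cov.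
rewrite -[X in _ *m X]trmxK -cov_mull// -cov_mulr//; last first.
  exact: square_integrable_mul.
by rewrite mxE fine_ge0// variance_ge0.
Qed.

(** Independence is assumed from stacked vectors; this reads off the vanishing covariance with each
    block. *)
Lemma cov_col_mxr m n p (V : T -> 'cV[R]_m) (W : T -> 'cV[R]_n)
    (W' : T -> 'cV[R]_p) :
  cov P V (fun w => col_mx (W w) (W' w)) = row_mx (cov P V W) (cov P V W').
Proof.
apply/matrixP => i j; rewrite !mxE; case: splitP => k jk; rewrite mxE;
  congr (fine (covariance P _ _)); apply/funext => w; rewrite /Defs.coord.
- by rewrite (_ : j = lshift p k) ?col_mxEu//; exact: val_inj.
- by rewrite (_ : j = rshift n k) ?col_mxEd//; exact: val_inj.
Qed.

Lemma square_integrable_col_mx m n (V : T -> 'cV[R]_m) (W : T -> 'cV[R]_n) :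
  square_integrable V -> square_integrable W ->
  square_integrable (fun w => col_mx (V w) (W w)).
Proof.
move=> V2 W2 i; case: (splitP i) => k ik.
- rewrite (_ : coord _ _ = coord V k)//; apply/funext => w.
  by rewrite /Defs.coord (_ : i = lshift n k) ?col_mxEu//; exact: val_inj.
- rewrite (_ : coord _ _ = coord W k)//; apply/funext => w.
  by rewrite /Defs.coord (_ : i = rshift m k) ?col_mxEd//; exact: val_inj.
Qed.

Lemma g_sigma_preimage_coord n (V : T -> 'cV[R]_n) i (A : set R) :
  measurable A -> g_sigma_preimage (coord V) (coord V i @^-1` A).
Proof.
move=> mA; apply: sub_gen_smallest; rewrite (bigD1 i)//=; left.
by exists A; rewrite ?setTI.
Qed.

Lemma cov_indep m n (V : T -> 'cV[R]_m) (W : T -> 'cV[R]_n) :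
  square_integrable V -> square_integrable W ->
  independent P V W -> cov P V W = 0.
Proof.
move=> V2 W2 VW; apply/matrixP => i j; rewrite !mxE.
rewrite covarianceE ?Lfun2_mulr_Lfun1 ?Lfun2_Lfun1// expectationM_indep//.
  by rewrite subee// fin_numM// expectation_fin_num// Lfun2_Lfun1.
by move=> A B mA mB; apply: VW; exact: g_sigma_preimage_coord.
Qed.

End covariance_matrix.

(** * Covariance of the analysis *)

Section control_variate_kalman.
Context {d : measure_display} {T : measurableType d} {R : realType}.
Variable P : probability T R.

Lemma cov_eq0_sym m n (V : T -> 'cV[R]_m) (W : T -> 'cV[R]_n) :
  cov P V W = 0 -> cov P W V = 0.
Proof. by move=> VW0; rewrite -trmx_cov VW0 trmx0. Qed.

(** The analysis equals [(1 - K H) V + K eta + K c]: the constant drops out of the covariance, and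
    the cross terms vanish by uncorrelatedness. *)
Lemma cov_analysis m n (H : 'M[R]_(m, n)) (K : 'M[R]_(n, m)) (c : 'cV[R]_m)
    (V : T -> 'cV[R]_n) (eta : T -> 'cV[R]_m) :
  square_integrable P V -> square_integrable P eta -> cov P V eta = 0 ->
  let Va := analysis H (fun w => c + eta w) V K in
  cov P Va Va = joseph_form (cov P V V) H (cov P eta eta) K.
Proof.
move=> V2 eta2 Veta0; rewrite /analysis.
rewrite (_ : (fun w => _) =
    fun w => ((1%:M - K *m H) *m V w + K *m eta w) + K *m c); last first.
  apply/funext => w; rewrite mulmxBr mulmxDr mulmxBl mul1mx mulmxA.
  rewrite opprB (addrC (K *m c)) -!addrA; congr (_ + _).
  by rewrite [RHS]addrC addrA.
have AV2 := square_integrable_mul (1%:M - K *m H) V2.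
have Keta2 := square_integrable_mul K eta2.
have s2 := square_integrableD AV2 Keta2.
have c2 := square_integrable_cst P (K *m c).
rewrite covDl//; last exact: square_integrableD.
rewrite cov_cstl addr0 covDr// cov_cstr addr0 covDl// !covDr//.
rewrite !cov_mull// !cov_mulr// Veta0 (cov_eq0_sym Veta0).
by rewrite !(mul0mx, mulmx0) addr0 add0r /joseph_form !mulmxA.
Qed.

(** * Variance reduction by the control variate *)

Section total_variate.
Variables (n r : nat) (X : T -> 'cV[R]_n) (Uhat U : T -> 'cV[R]_r).
Hypotheses (X2 : square_integrable P X) (Uhat2 : square_integrable P Uhat).
Hypothesis U2 : square_integrable P U.
Let S := control_gain P X Uhat U.
Let Z := total_variate S X Uhat U.

(** A sum of linear images, the shape to which bilinearity of [cov] applies. *)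
Let ZE : Z = fun w => X w + (- S *m Uhat w + S *m U w).
Proof.
apply/funext => w; rewrite /Z /total_variate mulmxBr mulNmx opprB.
by rewrite (addrC (- _)).
Qed.

Lemma square_integrable_total_variate : square_integrable P Z.
Proof.
rewrite ZE; apply: square_integrableD => //.
by apply: square_integrableD; exact: square_integrable_mul.
Qed.

Lemma cov_total_variate_eq0 m (W : T -> 'cV[R]_m) : square_integrable P W ->
  cov P W X = 0 -> cov P W Uhat = 0 -> cov P W U = 0 -> cov P Z W = 0.
Proof.
move=> W2 WX0 WUhat0 WU0; apply: cov_eq0_sym; rewrite ZE.
have SUhat2 := square_integrable_mul (- S) Uhat2.
have SU2 := square_integrable_mul S U2.
rewrite covDr//; last exact: square_integrableD.
by rewrite covDr// !cov_mulr// WX0 WUhat0 WU0 !mul0mx !addr0.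
Qed.

(* The difference is [S *m (cov P Uhat Uhat + cov P U U) *m S^T]. *)
Lemma loewner_le_cov_total_variate :
  cov P U X = 0 -> cov P U Uhat = 0 -> cov P Uhat Uhat + cov P U U \in unitmx ->
  loewner_le (cov P Z Z) (cov P X X).
Proof.
move=> UX0 UUhat0 Munit; set M := cov P Uhat Uhat + cov P U U in Munit.
(* Invertibility of [M] turns the definition of [S] into the normal equation of the regression. *)
have SM : cov P X Uhat = S *m M by rewrite mulmxKV.
have MT : M^T = M by rewrite linearD /= !trmx_cov.
have MS : cov P Uhat X = M *m S^T by rewrite -trmx_cov SM trmx_mul MT.
have SUhat2 := square_integrable_mul (- S) Uhat2.
have SU2 := square_integrable_mul S U2.
have SS2 := square_integrableD SUhat2 SU2.
rewrite /loewner_le (_ : _ - _ = S *m M *m S^T); last first.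
  rewrite ZE covDl//; last exact: square_integrableD.
  rewrite !covDr// !covDl// !cov_mull// !cov_mulr//.
  rewrite (cov_eq0_sym UX0) (cov_eq0_sym UUhat0) UX0 UUhat0.
  (* Each of the two cross terms with [X] contributes [- S M S^T], and the covariance of
     [S (Uhat - U)] contributes [S M S^T]. *)
  rewrite !(mul0mx, mulmx0, addr0, add0r) SM MS.
  rewrite linearN /= /M !(mulNmx, mulmxN, mulmxDl, mulmxDr) !mulmxA.
  move: (cov P X X) (S *m _ *m S^T) (S *m _ *m S^T) => x a b.
  by apply/matrixP => i j; rewrite !mxE; ring.
by apply/psdmx_congr/psdmxD; exact: psdmx_cov.
Qed.

End total_variate.

End control_variate_kalman.

(** * Comparison of the analysis covariances *)

Theorem theorem4p2 (d : measure_display) (T : measurableType d) (R : realType)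
    (P : probability T R) (n r m : nat)
    (Xt : 'cV[R]_n) (Xb : T -> 'cV[R]_n) (Uhat U : T -> 'cV[R]_r)
    (eta : T -> 'cV[R]_m) (H : 'M[R]_(m, n))
    (Xb_gauss : gaussian_vector P Xb)
    (Uhat_gauss : gaussian_vector P Uhat)
    (U_gauss : gaussian_vector P U)
    (eta_gauss : gaussian_vector P eta)
    (XbUhat_gauss : jointly_gaussian P Xb Uhat)
    (U_indep : independent P U (fun w => col_mx (Xb w) (Uhat w)))
    (eta_indep :
       independent P eta (fun w => col_mx (col_mx (Xb w) (Uhat w)) (U w)))
    (mean_Xb : mean P Xb = Xt)
    (mean_U : mean P U = mean P Uhat)
    (mean_eta : mean P eta = 0)
    (eta_posdef : posdefmx (cov P eta eta))
    (control_unit : cov P Uhat Uhat + cov P U U \in unitmx) :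
  let Y := fun w => H *m Xt + eta w in
  let S := control_gain P Xb Uhat U in
  let Zb := total_variate S Xb Uhat U in
  let Za := analysis H Y Zb in
  let Xa := analysis H Y Xb in
  let KZ := kalman_gain (cov P Zb Zb) H (cov P eta eta) in
  let KX := kalman_gain (cov P Xb Xb) H (cov P eta eta) in
  loewner_le (cov P (Za KZ) (Za KZ)) (cov P (Xa KX) (Xa KX)) /\
  loewner_le (cov P (Xa KX) (Xa KX)) (cov P (Xa KZ) (Xa KZ)).
Proof.
move=> Y S Zb Za Xa KZ KX.
have X2 : square_integrable P Xb by move=> i; exact: gaussian_vector_Lfun2.
have Uhat2 : square_integrable P Uhat by move=> i; exact: gaussian_vector_Lfun2.
have U2 : square_integrable P U by move=> i; exact: gaussian_vector_Lfun2.
have eta2 : square_integrable P eta by move=> i; exact: gaussian_vector_Lfun2.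
have XUhat2 := square_integrable_col_mx X2 Uhat2.
have XUhatU2 := square_integrable_col_mx XUhat2 U2.
have := cov_indep U2 XUhat2 U_indep.
rewrite cov_col_mxr -row_mx0 => /eq_row_mx[UX0 UUhat0].
have := cov_indep eta2 XUhatU2 eta_indep.
rewrite !cov_col_mxr -!row_mx0 => /eq_row_mx[/eq_row_mx[etaX0 etaUhat0] etaU0].
have Z2 : square_integrable P Zb by exact: square_integrable_total_variate.
have Zeta0 : cov P Zb eta = 0.
  exact: cov_total_variate_eq0.
have Xeta0 := cov_eq0_sym etaX0.
(* Every analysis covariance becomes a Joseph form, with [H *m Xt] as the constant shift in the
   observation. *)
rewrite !cov_analysis//.
have pX := psdmx_cov X2; have pZ := psdmx_cov Z2.
(* The right inequality is the optimality of [KX] for [Xb], tested against the gain [KZ]. *)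
split; last exact: kalman_gain_min.
(* The left inequality passes through the analysis of [Zb] with the gain [KX], suboptimal for it;
   monotonicity in the prior covariance then compares [Zb] with [Xb]. *)
apply: loewner_le_trans (kalman_gain_min _ KX pZ eta_posdef) _.
by apply: joseph_form_le; exact: loewner_le_cov_total_variate.
Qed.
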